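(* Let $\tau$ be a Euclidean triangle and let $G_\tau$ be its triangle group, with reflections $r_1,r_2,r_3$ and translation subgroup $T_\tau$ (see context). If $\tau$ is typical, then $T_\tau$ is the normal closure in $G_\tau$ of the translation $t_1=(r_1r_2r_3)^2$. Moreover, if $\tau$ is generic, then $T_\tau$ is a free abelian group having as a basis the conjugacy class $C(t_1)=\{g^{-1}t_1g \mid g\in G_\tau\}$ of $t_1$ in $G_\tau$.
   Context: A Euclidean triangle $\tau=A_1A_2A_3$ has edges $e_i=A_jA_k$ of length $\ell_i>0$ and interior angles $\alpha_i>0$ at $A_i$, where $\{i,j,k\}=\{1,2,3\}$. The triangle $\tau$ is generic if for some real $k>0$ the numbers $k\ell_1,k\ell_2,k\ell_3$ are algebraically independent over $\mathbb{Q}$. It is typical if $\alpha_1,\alpha_2,\alpha_3$ are linearly independent over $\mathbb{Q}$. Let $r_i$ be the reflection of the Euclidean plane across the line containing $e_i$, and let $G_\tau=\langle r_1,r_2,r_3\rangle$ be the subgroup of the Euclidean isometry group $\mathrm{E}(2)$ they generate (the triangle group). Isometries act on the right and products are composed left to right: $(x)gh=((x)g)h$. $T_\tau$ is the subgroup of all translations in $G_\tau$. *)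

(* Defs.v *)
From mathcomp Require Import all_boot all_algebra.
From mathcomp Require Import Rstruct.
From mathcomp Require Import mpoly.

Local Open Scope ring_scope.

Definition alg_indep3 (x y z : Rdefinitions.R) : Prop :=
  forall p : {mpoly rat[3]}, p != 0 ->
    (map_mpoly (ratr : rat -> Rdefinitions.R) p).@[tnth [tuple x; y; z]] != 0.

Definition lin_indep3 (x y z : Rdefinitions.R) : Prop :=
  forall a b c : rat,
    ratr a * x + ratr b * y + ratr c * z = 0 -> [/\ a = 0, b = 0 & c = 0].

Close Scope ring_scope.

From Stdlib Require Import Reals Lra ZArith List.
Open Scope R_scope.

Definition point : Type := (R * R)%type.
Definition padd (p q : point) : point := (fst p + fst q, snd p + snd q).
Definition psub (p q : point) : point := (fst p - fst q, snd p - snd q).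
Definition pscale (a : R) (p : point) : point := (a * fst p, a * snd p).
Definition dot (p q : point) : R := fst p * fst q + snd p * snd q.
Definition dist (p q : point) : R := sqrt (dot (psub p q) (psub p q)).

(** * The Euclidean isometry group E(2).
    An element is a distance-preserving bijection of the plane (stored with
    its inverse).  Isometries act on the right: (x)g is [app g x]. *)
Record isom : Type := Isom {
  app : point -> point;
  app_inv : point -> point;
  app_invK : forall x, app (app_inv x) = x;
  app_K : forall x, app_inv (app x) = x;
  app_dist : forall x y, dist (app x) (app y) = dist x y
}.

Lemma inv_dist (g : isom) x y : dist (app_inv g x) (app_inv g y) = dist x y.
Proof.
  rewrite -(app_dist g) !app_invK; reflexivity.
Qed.

Definition mul (g h : isom) : isom.
Proof.
  refine (Isom (fun x => app h (app g x)) (fun x => app_inv g (app_inv h x)) _ _ _).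
  - intro x; rewrite !app_invK; reflexivity.
  - intro x; rewrite !app_K; reflexivity.
  - intros x y; rewrite !app_dist; reflexivity.
Defined.

Definition inv (g : isom) : isom :=
  Isom (app_inv g) (app g) (app_K g) (app_invK g) (inv_dist g).

Definition one : isom :=
  Isom (fun x => x) (fun x => x) (fun x => @Logic.eq_refl _ x) (fun x => @Logic.eq_refl _ x)
       (fun x y => @Logic.eq_refl _ (dist x y)).

Fixpoint npow (g : isom) (n : nat) : isom :=
  match n with O => one | S n => mul g (npow g n) end.

Definition zpow (g : isom) (k : Z) : isom :=
  match k with
  | Z0 => one
  | Zpos p => npow g (Pos.to_nat p)
  | Zneg p => npow (inv g) (Pos.to_nat p)
  end.

Inductive gen (S : isom -> Prop) : isom -> Prop :=
  | gen_base s : S s -> gen S s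
  | gen_one : gen S one
  | gen_mul g h : gen S g -> gen S h -> gen S (mul g h)
  | gen_inv g : gen S g -> gen S (inv g).

Definition conj (g x : isom) : isom := mul (mul (inv g) x) g.

Definition conj_class (G : isom -> Prop) (x : isom) : isom -> Prop :=
  fun c => exists g, G g /\ c = conj g x.

Definition normal_closure (G : isom -> Prop) (x : isom) : isom -> Prop :=
  gen (conj_class G x).

Definition is_translation (g : isom) : Prop :=
  exists v : point, forall x, app g x = padd x v.

Definition free_abelian_with_basis (H B : isom -> Prop) : Prop :=
  (forall g h, H g -> H h -> mul g h = mul h g) /\
  (forall b, B b -> H b) /\
  (forall g, H g <-> gen B g) /\
  (forall (bs : list isom) (ks : list Z),
      NoDup bs -> Forall B bs -> length ks = length bs ->
      fold_right mul one (map (fun bk => zpow (fst bk) (snd bk)) (combine bs ks)) = one ->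
      Forall (fun k => k = 0%Z) ks).

(** Reflection across the line through P and Q (P <> Q). *)
Definition refl_fun (P Q x : point) : point :=
  let u := psub Q P in
  let t := dot (psub x P) u / dot u u in
  psub (pscale 2 (padd P (pscale t u))) x.

Lemma refl_fun_invol P Q x : refl_fun P Q (refl_fun P Q x) = x.
Proof.
  unfold refl_fun, psub, padd, pscale, dot; simpl.
  destruct P as [p1 p2], Q as [q1 q2], x as [x1 x2]; simpl.
  set (u1 := q1 - p1); set (u2 := q2 - p2).
  destruct (Req_dec (u1 * u1 + u2 * u2) 0) as [H|H].
  - assert (u1 = 0) by nra. assert (u2 = 0) by nra.
    rewrite H0 H1. f_equal; ring.
  - f_equal; field; assumption.
Qed.

Lemma refl_fun_dist P Q x y : dist (refl_fun P Q x) (refl_fun P Q y) = dist x y.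
Proof.
  unfold dist; f_equal.
  unfold refl_fun, psub, padd, pscale, dot; simpl.
  destruct P as [p1 p2], Q as [q1 q2], x as [x1 x2], y as [y1 y2]; simpl.
  set (u1 := q1 - p1); set (u2 := q2 - p2).
  destruct (Req_dec (u1 * u1 + u2 * u2) 0) as [H|H].
  - assert (u1 = 0) by nra. assert (u2 = 0) by nra.
    rewrite H0 H1. ring.
  - field; assumption.
Qed.

Definition reflection (P Q : point) : isom :=
  Isom (refl_fun P Q) (refl_fun P Q) (refl_fun_invol P Q) (refl_fun_invol P Q)
       (refl_fun_dist P Q).

Definition nondegenerate (A1 A2 A3 : point) : Prop :=
  let u := psub A2 A1 in let v := psub A3 A1 in
  fst u * snd v - snd u * fst v <> 0.

Definition angle (A B C : point) : R :=
  acos (dot (psub B A) (psub C A) / (dist A B * dist A C)).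

Definition len1 (A1 A2 A3 : point) := dist A2 A3.
Definition len2 (A1 A2 A3 : point) := dist A3 A1.
Definition len3 (A1 A2 A3 : point) := dist A1 A2.
Definition alpha1 (A1 A2 A3 : point) := angle A1 A2 A3.
Definition alpha2 (A1 A2 A3 : point) := angle A2 A3 A1.
Definition alpha3 (A1 A2 A3 : point) := angle A3 A1 A2.

Definition generic (A1 A2 A3 : point) : Prop :=
  exists k : R, 0 < k /\
    alg_indep3 (k * len1 A1 A2 A3) (k * len2 A1 A2 A3) (k * len3 A1 A2 A3).

Definition typical (A1 A2 A3 : point) : Prop :=
  lin_indep3 (alpha1 A1 A2 A3) (alpha2 A1 A2 A3) (alpha3 A1 A2 A3).

Definition r1 (A1 A2 A3 : point) := reflection A2 A3.
Definition r2 (A1 A2 A3 : point) := reflection A3 A1.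
Definition r3 (A1 A2 A3 : point) := reflection A1 A2.

Definition triangle_group (A1 A2 A3 : point) : isom -> Prop :=
  gen (fun g => g = r1 A1 A2 A3 \/ g = r2 A1 A2 A3 \/ g = r3 A1 A2 A3).

Definition translation_subgroup (A1 A2 A3 : point) : isom -> Prop :=
  fun g => triangle_group A1 A2 A3 g /\ is_translation g.

Definition t1 (A1 A2 A3 : point) : isom :=
  let w := mul (mul (r1 A1 A2 A3) (r2 A1 A2 A3)) (r3 A1 A2 A3) in mul w w.

(* Main.v *)
(** Identify the plane with the complex numbers. The reflection [r_i] has linear
    part [z |-> rho_i * conj z] with [rho_i = d_i / conj d_i], [d_i] a direction
    of the edge [e_i]. Put [a = r1 r2] and [b = r2 r3], rotations with linear
    parts [omega3] and [omega1]. As [t1 = a b^-1 a^-1 b], modulo the normal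
    closure of [t1] every element of the group is [a^m b^n] or [a^m b^n r1].
    Such an element can be a translation only if it is [a^m b^n] with
    [omega3^m omega1^n = 1], so it is enough that [omega3] and [omega1] are
    multiplicatively independent; for typical triangles this follows from the
    angle sum being a multiple of pi.

    The conjugates of [t1] are the translations by [omega3^m omega1^n v] for a
    fixed [v <> 0], so freeness of [C(t1)] amounts to the algebraic independence
    of [omega3] and [omega1]. These are rational functions of the sides and of
    [s = 4i Area], whose square is a polynomial in the sides. A polynomial
    relation between them reads [P + Q s = 0] with [P], [Q] polynomials in the
    sides; separating real and imaginary parts, genericity forces [P = Q = 0].
    The relation then holds at all points of the surface [s^2 = heron], in
    particular on a rational family where the two numbers are arbitrary squares
    [u^2] and [v^2], hence it is trivial. *)

From Stdlib Require Import Reals ZArith List Lra.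
From Stdlib Require Import FunctionalExtensionality ProofIrrelevance.
Require Import Defs.

(** * Signed angles and the inverse cosine *)

Section RealAngles.
Local Open Scope R_scope.

(** The value at [0] is [-1], so that the square is [1] without exception. *)
Definition sign_of (q : R) : R := if Rlt_dec 0 q then 1 else -1.

Lemma sign_of_sqr q : sign_of q * sign_of q = 1.
Proof. unfold sign_of; destruct (Rlt_dec 0 q); ring. Qed.

(** Values of [acos] have nonnegative sine, so [sin (acos (p / r))] is [|q| / r]; the sign of [q]
    restores the sine and leaves the cosine alone. *)
Lemma cos_sin_acos (p q r : R) : 0 < r -> r * r = p * p + q * q ->
  cos (sign_of q * acos (p / r)) = p / r /\ sin (sign_of q * acos (p / r)) = q / r.
Proof.
intros Hr E.
assert (Hx : (p / r) * (p / r) + (q / r) * (q / r) = 1).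
{ replace (p / r * (p / r) + q / r * (q / r)) with ((p * p + q * q) / (r * r)) by (field; lra).
  rewrite <- E; field; lra. }
set (x := p / r) in *; set (y := q / r) in *.
assert (Hq : q = y * r) by (unfold y; field; lra).
assert (B : -1 <= x <= 1) by (split; nra).
destruct (acos_bound x) as [b1 b2].
pose proof (sin_ge_0 _ b1 b2) as S0.
pose proof (sin2_cos2 (acos x)) as S2; unfold Rsqr in S2.
pose proof (cos_acos x B) as Ec; rewrite Ec in S2.
unfold sign_of; destruct (Rlt_dec 0 q) as [Hp|Hn].
- rewrite Rmult_1_l; split; [exact Ec|].
  assert (0 < y) by nra.
  assert (F : (sin (acos x) - y) * (sin (acos x) + y) = 0) by nra.
  destruct (Rmult_integral _ _ F); lra.
- replace (-1 * acos x) with (- acos x) by ring.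
  rewrite cos_neg, sin_neg; split; [exact Ec|].
  assert (y <= 0) by nra.
  assert (F : (sin (acos x) - y) * (sin (acos x) + y) = 0) by nra.
  destruct (Rmult_integral _ _ F); lra.
Qed.

Lemma cos_double_eq1 x : cos (x + x) = 1 -> exists k : Z, x = IZR k * PI.
Proof.
intro H; apply sin_eq_0_0; apply Rsqr_0_uniq.
pose proof (sin2_cos2 x) as E; rewrite cos_plus in H; unfold Rsqr in *; lra.
Qed.

Lemma dist_sqr P Q : dist P Q * dist P Q = dot (psub P Q) (psub P Q).
Proof.
apply sqrt_sqrt; apply Rplus_le_le_0_compat; apply Rle_0_sqr.
Qed.

Lemma dist_gt0 P Q : 0 < dot (psub P Q) (psub P Q) -> 0 < dist P Q.
Proof. exact (sqrt_lt_R0 _). Qed.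

Lemma sum_sqr_gt0 a b c d : a * c - b * d <> 0 -> 0 < a * a + b * b.
Proof.
intro H; destruct (Rle_lt_dec (a * a + b * b) 0) as [L|L]; [exfalso | exact L].
pose proof (Rle_0_sqr a) as Ha; pose proof (Rle_0_sqr b) as Hb; unfold Rsqr in Ha, Hb.
assert (a = 0) by (apply Rsqr_0_uniq; unfold Rsqr; lra).
assert (b = 0) by (apply Rsqr_0_uniq; unfold Rsqr; lra).
apply H; subst; ring.
Qed.

(** This is the imaginary part of [(B - A) * conj (D - A)], the opposite of the usual
    determinant. *)
Definition orient (A B D : point) : R :=
  snd (psub B A) * fst (psub D A) - fst (psub B A) * snd (psub D A).

Lemma orient_rot A B D : orient A B D = orient B D A.
Proof. unfold orient, psub; simpl; ring. Qed.

Lemma cos_sin_angle A B D : orient A B D <> 0 ->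
  let r := dist A B * dist A D in
  let s := sign_of (orient A B D) in
  0 < r /\
  r * r = dot (psub B A) (psub D A) * dot (psub B A) (psub D A)
          + orient A B D * orient A B D /\
  cos (s * angle A B D) = dot (psub B A) (psub D A) / r /\
  sin (s * angle A B D) = orient A B D / r.
Proof.
intros Ho r s.
assert (Hr : 0 < r).
{ apply Rmult_lt_0_compat; apply dist_gt0; unfold orient, dot, psub in *; simpl in *.
  - apply (sum_sqr_gt0 _ _ (snd D - snd A) (fst D - fst A)); lra.
  - apply (sum_sqr_gt0 _ _ (snd B - snd A) (fst B - fst A)); lra. }
assert (E : r * r = dot (psub B A) (psub D A) * dot (psub B A) (psub D A)
          + orient A B D * orient A B D).
{ transitivity ((dist A B * dist A B) * (dist A D * dist A D)); [unfold r; ring|].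
  rewrite !dist_sqr; unfold orient, dot, psub; simpl; ring. }
split; [exact Hr|]; split; [exact E|].
exact (cos_sin_acos _ _ _ Hr E).
Qed.

End RealAngles.

From mathcomp Require Import all_boot all_order all_algebra.
From mathcomp Require Import Rstruct.
From mathcomp Require Import mpoly complex ring zify ssrZ.
Import Defs.

Set Implicit Arguments.
Unset Strict Implicit.
Unset Printing Implicit Defensive.

Import GRing.Theory Num.Theory.
Local Open Scope ring_scope.
Local Notation C := (complex Rdefinitions.R).

(** * Isometries as maps of the complex plane *)

Lemma isom_ext (g h : isom) : (forall x, app g x = app h x) -> g = h.
Proof.
case: g h => [f fi K1 K2 D] [f' fi' K1' K2' D'] /= E.
have Ef : f = f' by apply: functional_extensionality.
subst f'.
(* The inverse is determined by the map; the remaining fields are proofs. *)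
have Ei : fi = fi' by apply: functional_extensionality => x; rewrite -{1}(K1' x) K2.
subst fi'.
by f_equal; apply: proof_irrelevance.
Qed.

Definition toC (p : point) : C := Complex p.1 p.2.

Lemma toC_inj p q : toC p = toC q -> p = q.
Proof. by case: p q => [a b] [c d] [-> ->]. Qed.

Lemma toCB p q : toC (psub p q) = toC p - toC q.
Proof. by []. Qed.

Lemma toCD p q : toC (padd p q) = toC p + toC q.
Proof. by []. Qed.

Lemma toCZ a p : toC (pscale a p) = (real_complex _ a) * toC p.
Proof. by apply/eqP; rewrite eq_complex /= RmultE !mul0r subr0 addr0 !eqxx. Qed.

Lemma dotE p q :
  real_complex _ (dot p q) = (toC p * conjc (toC q) + conjc (toC p) * toC q) / 2%:R.
Proof.
have two0 : (2%:R : C) != 0 by rewrite pnatr_eq0.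
apply: (mulIf two0); rewrite mulfVK //.
apply/eqP; rewrite eq_complex /= /dot /=; apply/andP; split; apply/eqP; rewrite !RealsE; ring.
Qed.

Ltac isom_eq := apply: isom_ext => ? /=; rewrite ?app_K ?app_invK ?app_K.

(** * The triangle group modulo the normal closure of [t1] *)

Definition ipow (g : isom) (m : int) : isom :=
  match m with Posz n => npow g n | Negz n => npow (inv g) n.+1 end.

Lemma npowSr g n : npow g n.+1 = mul (npow g n) g.
Proof.
elim: n => [|n IH]; first by isom_eq.
by transitivity (mul g (npow g n.+1)); rewrite // {1}IH; isom_eq.
Qed.

Lemma ipowSr g m : mul (ipow g m) g = ipow g (m + 1).
Proof.
case: m => [n|[|n]].
- by rewrite -PoszD addn1 /ipow npowSr.
- by isom_eq.
- rewrite (_ : Negz n.+1 + 1 = Negz n); last by rewrite !NegzE -addn1 PoszD opprD addrNK.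
  by rewrite /ipow npowSr; isom_eq.
Qed.

Lemma ipowPr g m : mul (ipow g m) (inv g) = ipow g (m - 1).
Proof. by rewrite -{1}(subrK 1 m) -ipowSr; isom_eq. Qed.

Lemma gen_ipow S g m : gen S g -> gen S (ipow g m).
Proof.
move=> Sg; have np h n : gen S h -> gen S (npow h n).
  by move=> Sh; elim: n => [|n IH] /=; [exact: gen_one | exact: gen_mul].
by case: m => n; apply: np => //; apply: gen_inv.
Qed.

Definition comm (g h : isom) : isom := mul (mul (mul g h) (inv g)) (inv h).

(** * Normal forms in a group generated by three involutions *)

Section NormalForm.
Variables q1 q2 q3 : isom.
Hypotheses (q1K : forall x, app q1 (app q1 x) = x) (q2K : forall x, app q2 (app q2 x) = x)
  (q3K : forall x, app q3 (app q3 x) = x).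

Let G := gen (fun g => g = q1 \/ g = q2 \/ g = q3).
Let t := let w := mul (mul q1 q2) q3 in mul w w.
Let N := normal_closure G t.
Let a := mul q1 q2.
Let b := mul q2 q3.

Let q1V x : app_inv q1 x = app q1 x. Proof. by rewrite -{1}(q1K x) app_K. Qed.
Let q2V x : app_inv q2 x = app q2 x. Proof. by rewrite -{1}(q2K x) app_K. Qed.
Let q3V x : app_inv q3 x = app q3 x. Proof. by rewrite -{1}(q3K x) app_K. Qed.

Ltac refl_eq := apply: isom_ext => ? /=;
  do ?rewrite ?q1V ?q2V ?q3V ?q1K ?q2K ?q3K ?app_K ?app_invK.

Lemma G_q1 : G q1. Proof. by apply: gen_base; left. Qed.
Lemma G_q2 : G q2. Proof. by apply: gen_base; right; left. Qed.
Lemma G_q3 : G q3. Proof. by apply: gen_base; right; right. Qed.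
Lemma G_a : G a. Proof. exact: gen_mul G_q1 G_q2. Qed.
Lemma G_b : G b. Proof. exact: gen_mul G_q2 G_q3. Qed.

Lemma normal_closure_conj g u : G g -> N u -> N (conj g u).
Proof.
move=> Gg; elim=> [s [h [Gh ->]]||x y _ IHx _ IHy|x _ IHx].
- rewrite (_ : conj g (conj h t) = conj (mul h g) t); last by isom_eq.
  by apply: gen_base; exists (mul h g); split=> //; apply: gen_mul.
- by rewrite (_ : conj g one = one); [exact: gen_one | isom_eq].
- rewrite (_ : conj g (mul x y) = mul (conj g x) (conj g y)); last by isom_eq.
  exact: gen_mul.
- rewrite (_ : conj g (inv x) = inv (conj g x)); last by isom_eq.
  exact: gen_inv.
Qed.

(** Follows from the identity [[g h, k] = (g [h, k] g^-1) [g, k]]. *)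
Lemma commM_closure g h k : G g -> N (comm g k) -> N (comm h k) -> N (comm (mul g h) k).
Proof.
move=> Gg Ng Nh.
rewrite (_ : comm _ _ = mul (conj (inv g) (comm h k)) (comm g k)); last by isom_eq.
by apply: gen_mul => //; apply: normal_closure_conj => //; apply: gen_inv.
Qed.

Lemma commV_closure g k : G g -> N (comm g k) -> N (comm (inv g) k).
Proof.
move=> Gg Ng.
rewrite (_ : comm _ _ = conj g (inv (comm g k))); last by isom_eq.
by apply: normal_closure_conj => //; apply: gen_inv.
Qed.

Lemma commC_closure g k : N (comm g k) -> N (comm k g).
Proof. by move=> Ng; rewrite (_ : comm k g = inv (comm g k)); [apply: gen_inv | isom_eq]. Qed.

Lemma comm_ipow_closure g k m : G g -> N (comm g k) -> N (comm (ipow g m) k).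
Proof.
move=> Gg Ng.
have np h n : G h -> N (comm h k) -> N (comm (npow h n) k).
  move=> Gh Nh; elim: n => [|n IH] /=; last exact: commM_closure.
  by rewrite (_ : comm one k = one); [exact: gen_one | isom_eq].
by case: m => n; apply: np => //; [apply: gen_inv | apply: commV_closure].
Qed.

(** As the generators are involutions, [a b^-1 a^-1 b = q1 q2 q3 q1 q2 q3], which is [t]; hence [a]
    and [b] commute modulo [N]. *)
Lemma comm_ab_closure : N (comm b a).
Proof.
have : N (comm a (inv b)).
  rewrite (_ : comm _ _ = conj one t); last by refl_eq.
  by apply: gen_base; exists one; split=> //; exact: gen_one.
move/commC_closure/(commV_closure (gen_inv _ _ G_b)).
by rewrite (_ : inv (inv b) = b); last isom_eq.
Qed.

Definition normal_word (m n : int) (e : bool) : isom :=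
  mul (mul (ipow a m) (ipow b n)) (if e then q1 else one).

(** Moving [k] to the left of [b^n] costs the commutator [[b^n, k]], which is then carried to the
    front by conjugation with [a^m]. *)
Let step_a m n k : N (comm b k) -> G k ->
  exists2 u, N u & mul (mul (ipow a m) (ipow b n)) k = mul u (mul (mul (ipow a m) k) (ipow b n)).
Proof.
move=> Nk Gk; exists (conj (inv (ipow a m)) (comm (ipow b n) k)); last by isom_eq.
apply: normal_closure_conj; first by apply/gen_inv/gen_ipow/G_a.
by apply: comm_ipow_closure => //; exact: G_b.
Qed.

Let step_aS m n : exists2 u, N u &
  mul (mul (ipow a m) (ipow b n)) a = mul u (mul (ipow a (m + 1)) (ipow b n)).
Proof. by rewrite -ipowSr; apply: step_a comm_ab_closure G_a. Qed.

Let step_aP m n : exists2 u, N u &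
  mul (mul (ipow a m) (ipow b n)) (inv a) = mul u (mul (ipow a (m - 1)) (ipow b n)).
Proof.
rewrite -ipowPr; apply: step_a (gen_inv _ _ G_a).
exact/commC_closure/(commV_closure G_a)/commC_closure/comm_ab_closure.
Qed.

Lemma normal_word_q m n e q : q = q1 \/ q = q2 \/ q = q3 ->
  exists u m' n' e', N u /\ mul (normal_word m n e) q = mul u (normal_word m' n' e').
Proof.
rewrite /normal_word.
(* After a final [q1] the generators complete to [q1 q1 = 1], [q1 q2 = a] and [q1 q3 = a b];
   otherwise they are rewritten as [q1], [q2 = a^-1 q1] and [q3 = b^-1 a^-1 q1]. *)
case: e => -[->|[->|->]].
- by exists one, m, n, false; split; [exact: gen_one | refl_eq].
- have [u Nu E] := step_aS m n; exists u, (m + 1), n, false; split=> //.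
  transitivity (mul (mul (mul (ipow a m) (ipow b n)) a) one); first by refl_eq.
  by rewrite E; isom_eq.
- have [u Nu E] := step_aS m n; exists u, (m + 1), (n + 1), false; split=> //.
  transitivity (mul (mul (mul (ipow a m) (ipow b n)) a) b); first by refl_eq.
  by rewrite E -(ipowSr b n); isom_eq.
- by exists one, m, n, true; split; [exact: gen_one | isom_eq].
- have [u Nu E] := step_aP m n; exists u, (m - 1), n, true; split=> //.
  transitivity (mul (mul (mul (ipow a m) (ipow b n)) (inv a)) q1); first by refl_eq.
  by rewrite E; isom_eq.
- have [u Nu E] := step_aP m (n - 1); exists u, (m - 1), (n - 1), true; split=> //.
  transitivity (mul (mul (mul (mul (ipow a m) (ipow b n)) (inv b)) (inv a)) q1); first by refl_eq.
  rewrite (_ : mul (mul (ipow a m) (ipow b n)) (inv b) = mul (ipow a m) (ipow b (n - 1))).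
    by rewrite E; isom_eq.
  by rewrite -ipowPr; isom_eq.
Qed.

Lemma normal_form g : G g -> exists u m n e, N u /\ g = mul u (normal_word m n e).
Proof.
pose P h := exists u m n e, N u /\ h = mul u (normal_word m n e).
have base q h : q = q1 \/ q = q2 \/ q = q3 -> P h -> P (mul h q).
  move=> Hq [u [m [n [e [Nu ->]]]]].
  have [u' [m' [n' [e' [Nu' E]]]]] := normal_word_q m n e Hq.
  exists (mul u u'), m', n', e'; split; first exact: gen_mul.
  transitivity (mul u (mul (normal_word m n e) q)); first by isom_eq.
  by rewrite E; isom_eq.
(* Closure under right multiplication by [g] and by its inverse is proved jointly, so that the
   induction passes through [gen_inv]. *)
suff K : G g -> forall h, P h -> P (mul h g) /\ P (mul h (inv g)).
  move=> Gg; have -> : g = mul one g by isom_eq.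
  apply: (K Gg one _).1; exists one, 0, 0, false.
  by split; [exact: gen_one | isom_eq].
elim=> [q Hq||x y _ IHx _ IHy|x _ IHx] h Ph.
- split; first exact: base.
  rewrite (_ : inv q = q); first exact: base.
  by case: Hq => [->|[->|->]]; refl_eq.
- have -> : mul h (inv one) = h by isom_eq.
  by have -> : mul h one = h by isom_eq.
- rewrite (_ : mul h (mul x y) = mul (mul h x) y); last by isom_eq.
  rewrite (_ : mul h (inv _) = mul (mul h (inv y)) (inv x)); last by isom_eq.
  have [Phx _] := IHx h Ph; have [Phxy _] := IHy _ Phx.
  by have [_ Phy] := IHy h Ph; have [_ Phyx] := IHx _ Phy.
- rewrite (_ : inv (inv x) = x); last by isom_eq.
  by have [] := IHx h Ph.
Qed.

End NormalForm.

(** * Algebraic independence of the rotations of a generic triangle *)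

Definition evalC (p : {mpoly rat[3]}) (x y z : C) : C :=
  (map_mpoly (ratr : rat -> C) p).@[tnth [tuple x; y; z]].

Lemma evalCD p q x y z : evalC (p + q) x y z = evalC p x y z + evalC q x y z.
Proof. by rewrite /evalC rmorphD /= mevalD. Qed.

Lemma evalCM p q x y z : evalC (p * q) x y z = evalC p x y z * evalC q x y z.
Proof. by rewrite /evalC rmorphM /= mevalM. Qed.

Lemma evalC_int k x y z : evalC k%:~R x y z = k%:~R.
Proof. by rewrite /evalC !rmorph_int. Qed.

Lemma evalC_var i x y z : evalC 'X_i x y z = tnth [tuple x; y; z] i.
Proof. by rewrite /evalC map_mpolyX mevalXU. Qed.

Lemma evalC_real p (x y z : Rdefinitions.R) :
  evalC p (real_complex _ x) (real_complex _ y) (real_complex _ z) =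
  real_complex _ ((map_mpoly (ratr : rat -> Rdefinitions.R) p).@[tnth [tuple x; y; z]]).
Proof.
elim/mpolyind: p => [|c m p _ _ IH].
  by rewrite /evalC !rmorph0.
rewrite evalCD rmorphD mevalD rmorphD IH; congr (_ + _).
rewrite /evalC /= !map_mpolyZ /= !mevalZ !map_mpolyX !mevalX rmorphM /= fmorph_rat rmorph_prod.
by congr (_ * _); apply: eq_bigr => -[[|[|[|//]]] i3] _; rewrite rmorphXn.
Qed.

(* [heron] is [- (4 Area)^2] for the triangle with sides [x], [y], [z]. *)
Definition heron (x y z : C) : C :=
  x ^+ 4 + y ^+ 4 + z ^+ 4 - 2%:R * (x ^+ 2 * y ^+ 2 + y ^+ 2 * z ^+ 2 + z ^+ 2 * x ^+ 2).

(** These are the polynomial functions with rational coefficients on the surface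
    [s ^+ 2 = heron x y z], reduced to degree at most one in [s]. One pair [p], [q] serves all
    points, which lets a vanishing statement pass from one triangle to the whole surface. *)
Definition heron_rep (f : C -> C -> C -> C -> C) : Prop :=
  exists p q : {mpoly rat[3]}, forall x y z s, s ^+ 2 = heron x y z ->
    f x y z s = evalC p x y z + evalC q x y z * s.

Lemma heron_rep_poly p : heron_rep (fun x y z _ => evalC p x y z).
Proof. by exists p, 0 => x y z s _; rewrite -[0]/(0%:~R) evalC_int mul0r addr0. Qed.

Lemma heron_rep_int k : heron_rep (fun _ _ _ _ => k%:~R).
Proof.
have [p [q H]] := heron_rep_poly k%:~R.
by exists p, q => x y z s hs; rewrite -H // evalC_int.
Qed.

Lemma heron_rep_area : heron_rep (fun _ _ _ s => s).
Proof.
exists 0, 1 => x y z s _.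
by rewrite -[0]/(0%:~R) -[1]/(1%:~R) !evalC_int add0r mul1r.
Qed.

Lemma heron_repD f g : heron_rep f -> heron_rep g ->
  heron_rep (fun x y z s => f x y z s + g x y z s).
Proof.
move=> [p [q H]] [p' [q' H']]; exists (p + p'), (q + q') => x y z s hs.
by rewrite H // H' // !evalCD mulrDl addrACA.
Qed.

Lemma heron_repM f g : heron_rep f -> heron_rep g ->
  heron_rep (fun x y z s => f x y z s * g x y z s).
Proof.
move=> [p [q H]] [p' [q' H']].
have [D DE] : exists D, forall x y z, evalC D x y z = heron x y z.
  pose X : {mpoly rat[3]} := 'X_(inord 0); pose Y : {mpoly rat[3]} := 'X_(inord 1).
  pose Z : {mpoly rat[3]} := 'X_(inord 2).
  exists (X * X * (X * X) + Y * Y * (Y * Y) + Z * Z * (Z * Z)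
    + (-2)%:~R * (X * X * (Y * Y) + Y * Y * (Z * Z) + Z * Z * (X * X))) => x y z.
  rewrite !(evalCD, evalCM) evalC_int !evalC_var !(tnth_nth 0) !inordK //=.
  by rewrite /heron; ring.
exists (p * p' + q * q' * D), (p * q' + q * p') => x y z s hs.
rewrite H // H' // !evalCD !evalCM DE -hs.
by move: (evalC p _ _ _) (evalC q _ _ _) (evalC p' _ _ _) (evalC q' _ _ _) => a b a' b'; ring.
Qed.

Lemma heron_repX f n : heron_rep f -> heron_rep (fun x y z s => f x y z s ^+ n).
Proof.
move=> Hf; elim: n => [|n IH]; first exact: (heron_rep_int 1).
have [p [q H]] := heron_repM Hf IH.
by exists p, q => x y z s hs; rewrite -H // exprS.
Qed.

Lemma heron_rep_sum (T : Type) (r : seq T) (F : T -> C -> C -> C -> C -> C) :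
  (forall t, heron_rep (F t)) -> heron_rep (fun x y z s => \sum_(t <- r) F t x y z s).
Proof.
move=> HF; elim: r => [|t r IH].
  have [p [q H]] := heron_rep_int 0.
  by exists p, q => x y z s hs; rewrite -H // big_nil.
have [p [q H]] := heron_repD (HF t) IH.
by exists p, q => x y z s hs; rewrite -H // big_cons.
Qed.

(** Sampling starts at [2] because the family of [heron_param] degenerates when a parameter is [0]
    or [1]. *)
Lemma poly_nat_roots (p : {poly C}) : (forall n : nat, p.[n.+2%:R] = 0) -> p = 0.
Proof.
move=> H; apply/eqP/negPn/negP => p0.
pose s : seq C := [seq n.+2%:R | n <- iota 0 (size p)].
have rs : all (root p) s by apply/allP => x /mapP[n _ ->]; rewrite /root H.
have us : uniq s.
  by rewrite map_inj_uniq ?iota_uniq // => i j /eqP; rewrite eqr_nat => /eqP[].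
by have := max_poly_roots p0 rs us; rewrite size_map size_iota ltnn.
Qed.

Lemma poly_sparse_eq0 (T : eqType) (r : seq T) (e : T -> nat) (k : T -> int) :
  uniq r -> {in r &, injective e} ->
  \sum_(t <- r) (k t)%:~R *: 'X^(e t) = 0 :> {poly C} -> {in r, forall t, k t = 0}.
Proof.
move=> ur ie /polyP E t rt; have := E (e t).
rewrite coef0 coef_sum (bigD1_seq t) //= big_seq_cond big1; last first.
  move=> i /andP[ri it]; rewrite coefZ coefXn.
  case: eqP => [et|]; last by rewrite mulr0.
  by rewrite (ie t i) // eqxx in it.
by rewrite addr0 coefZ coefXn eqxx mulr1 => /eqP; rewrite intr_eq0 => /eqP.
Qed.

(** By the law of cosines, if [s] is [4 i] times a signed area, the quotient by [2 x y] is the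
    exponential of [i] times the signed angle between the sides [x] and [y]. *)
Definition cos_num (x y z s : C) : C := x ^+ 2 + y ^+ 2 - z ^+ 2 + s.

Lemma heron_rep_cos_num : heron_rep cos_num /\ heron_rep (fun x y z s => cos_num y z x s).
Proof.
pose X : {mpoly rat[3]} := 'X_(inord 0); pose Y : {mpoly rat[3]} := 'X_(inord 1).
pose Z : {mpoly rat[3]} := 'X_(inord 2).
split.
- have [p [q H]] := heron_repD (heron_rep_poly (X * X + Y * Y + (-1)%:~R * (Z * Z))) heron_rep_area.
  exists p, q => x y z s hs; rewrite -H //.
  rewrite !(evalCD, evalCM) evalC_int !evalC_var !(tnth_nth 0) !inordK //= /cos_num; ring.
- have [p [q H]] := heron_repD (heron_rep_poly (Y * Y + Z * Z + (-1)%:~R * (X * X))) heron_rep_area.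
  exists p, q => x y z s hs; rewrite -H //.
  rewrite !(evalCD, evalCM) evalC_int !evalC_var !(tnth_nth 0) !inordK //= /cos_num; ring.
Qed.

Lemma heron_rep_prod2 : heron_rep (fun x y z s => (2%:R * x * y) ^+ 2) /\
   heron_rep (fun x y z s => (2%:R * y * z) ^+ 2).
Proof.
have H i j : heron_rep
    (fun x y z s => (2%:R * tnth [tuple x; y; z] i * tnth [tuple x; y; z] j) ^+ 2).
  apply: heron_repX.
  have [p [q H]] := heron_rep_poly (2%:~R * 'X_i * 'X_j).
  by exists p, q => x y z s hs; rewrite -H // !evalCM evalC_int !evalC_var.
split.
- have [p [q Hp]] := H (inord 0) (inord 1).
  by exists p, q => x y z s hs; rewrite -Hp // !(tnth_nth 0) !inordK.
- have [p [q Hp]] := H (inord 1) (inord 2).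
  by exists p, q => x y z s hs; rewrite -Hp // !(tnth_nth 0) !inordK.
Qed.

(* Rational points of [s ^+ 2 = heron x y z] at which the two quotients
   [cos_num / (2 x y)] and [cos_num / (2 y z)] take prescribed values [u], [v]. *)
Lemma heron_param (u v : C) :
  let x := (v ^+ 2 - 1) * u in let y := u ^+ 2 * v ^+ 2 - 1 in let z := (u ^+ 2 - 1) * v in
  let s := (u ^+ 2 - 1) * (v ^+ 2 - 1) * (u ^+ 2 * v ^+ 2 - 1) in
  [/\ s ^+ 2 = heron x y z, cos_num x y z s = u * (2%:R * x * y)
    & cos_num y z x s = v * (2%:R * y * z)].
Proof. by rewrite /heron /cos_num /=; split; ring. Qed.

(** Clears the denominators [d ^+ 2] and [e ^+ 2], with [M] bounding the degree in each variable. *)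
Lemma homogenize_sum (r : seq (nat * nat * int)) (M : nat) (u v d e : C) :
  {in r, forall t, (t.1.1 <= M)%N && (t.1.2 <= M)%N} ->
  \sum_(t <- r) t.2%:~R * ((u * d) ^+ 2) ^+ t.1.1 * (d ^+ 2) ^+ (M - t.1.1)
     * (((v * e) ^+ 2) ^+ t.1.2 * (e ^+ 2) ^+ (M - t.1.2)) =
  (d ^+ 2) ^+ M * (e ^+ 2) ^+ M *
    \sum_(t <- r) t.2%:~R * (u ^+ 2) ^+ t.1.1 * (v ^+ 2) ^+ t.1.2.
Proof.
move=> H; rewrite mulr_sumr; apply: eq_big_seq => t /H /andP[/subnKC Em /subnKC En].
have -> : (d ^+ 2) ^+ M = (d ^+ 2) ^+ t.1.1 * (d ^+ 2) ^+ (M - t.1.1) by rewrite -exprD Em.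
have -> : (e ^+ 2) ^+ M = (e ^+ 2) ^+ t.1.2 * (e ^+ 2) ^+ (M - t.1.2) by rewrite -exprD En.
by rewrite !exprMn; ring.
Qed.

Lemma absz_shift (m : int) (N : nat) : (`|m| <= N)%N -> (absz (m + N%:Z))%:Z = m + N%:Z.
Proof. by lia. Qed.

(** * Relations at a point with independent real sides and imaginary [s0] *)

Section AlgIndep.
Variables (l1 l2 l3 sg : Rdefinitions.R).
Hypotheses (indep : alg_indep3 l1 l2 l3) (l1n0 : l1 != 0) (l2n0 : l2 != 0) (l3n0 : l3 != 0)
  (sgn0 : sg != 0).
Let x1 : C := real_complex _ l1.
Let x2 : C := real_complex _ l2.
Let x3 : C := real_complex _ l3.
Let s0 : C := Complex 0 sg.
Hypothesis s0E : s0 ^+ 2 = heron x1 x2 x3.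
Let u0 := cos_num x1 x2 x3 s0 / (2%:R * x1 * x2).
Let v0 := cos_num x2 x3 x1 s0 / (2%:R * x2 * x3).

Let x12_neq0 : 2%:R * x1 * x2 != 0.
Proof. by rewrite !mulf_neq0 ?pnatr_eq0 // eq_complex /= eqxx andbT. Qed.

Let x23_neq0 : 2%:R * x2 * x3 != 0.
Proof. by rewrite !mulf_neq0 ?pnatr_eq0 // eq_complex /= eqxx andbT. Qed.

(* As [s0] is purely imaginary and the sides are real, the two components of a
   represented function that vanishes at the given triangle vanish separately,
   hence vanish identically by algebraic independence. *)
Lemma heron_rep_vanish f : heron_rep f -> f x1 x2 x3 s0 = 0 ->
  forall x y z s, s ^+ 2 = heron x y z -> f x y z s = 0.
Proof.
move=> [p [q H]] f0.
have := H _ _ _ _ s0E; rewrite f0 /x1 /x2 /x3 !evalC_real /s0 => /eqP.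
set vp := meval _ _; set vq := meval _ _.
rewrite eq_sym eq_complex /= !mul0r !mulr0 subr0 !addr0 add0r mulf_eq0 (negPf sgn0) orbF.
move=> /andP[/eqP vp0 /eqP vq0].
have zero r : (map_mpoly (ratr : rat -> Rdefinitions.R) r).@[tnth [tuple l1; l2; l3]] = 0 -> r = 0.
  by move=> r0; apply/eqP/negPn/negP => /indep; rewrite r0 eqxx.
move=> x y z s hs; rewrite H // (zero p vp0) (zero q vq0).
by rewrite -[0 : {mpoly rat[3]}]/(0%:~R) !evalC_int mul0r addr0.
Qed.

(** Clearing denominators gives a represented function [f] that vanishes at the given triangle,
    hence on the surface. On the family of [heron_param], with [v] a suitable power of [u], it
    becomes a sparse polynomial in [u] alone. *)
Lemma nat_terms_eq0 (r : seq (nat * nat * int)) : uniq [seq t.1 | t <- r] ->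
  \sum_(t <- r) t.2%:~R * (u0 ^+ 2) ^+ t.1.1 * (v0 ^+ 2) ^+ t.1.2 = 0 ->
  {in r, forall t, t.2 = 0}.
Proof.
move=> ur r0.
pose M := (\max_(t <- r) maxn t.1.1 t.1.2)%N.
have leM : {in r, forall t, (t.1.1 <= M)%N && (t.1.2 <= M)%N}.
  by move=> t rt; rewrite -geq_max; apply: leq_bigmax_seq.
pose f x y z s := \sum_(t <- r) t.2%:~R * ((cos_num x y z s) ^+ 2) ^+ t.1.1
     * ((2%:R * x * y) ^+ 2) ^+ (M - t.1.1)
     * ((cos_num y z x s ^+ 2) ^+ t.1.2 * ((2%:R * y * z) ^+ 2) ^+ (M - t.1.2)).
have [c1 c2] := heron_rep_cos_num; have [d1 d2] := heron_rep_prod2.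
have rep_f : heron_rep f.
  apply: heron_rep_sum => t.
  apply: heron_repM; apply: heron_repM; try exact: heron_repX.
    apply: heron_repM; first exact: heron_rep_int.
    exact/heron_repX/heron_repX.
  exact/heron_repX/heron_repX.
have f0 : f x1 x2 x3 s0 = 0.
  rewrite /f -(divfK x12_neq0 (cos_num x1 x2 x3 s0)) -(divfK x23_neq0 (cos_num x2 x3 x1 s0)).
  by rewrite (homogenize_sum _ _ _ _ leM) r0 mulr0.
have zf := heron_rep_vanish rep_f f0.
(* Kronecker substitution: this is the exponent of [u] once [v = u ^+ M.+1]. Both exponents of a
   term are at most [M], so they are the digits of a number in base [M.+1] and can be recovered. *)
pose e (t : nat * nat * int) := (2 * (t.1.1 + M.+1 * t.1.2))%N.
have ie : {in r &, injective e}.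
  move=> t t' rt rt' /eqP; rewrite eqn_mul2l /= => /eqP E.
  have /andP[lt1 _] := leM _ rt; have /andP[lt1' _] := leM _ rt'.
  have E1 : t.1.1 = t'.1.1.
    have /(congr1 (modn^~ M.+1)) := E.
    by rewrite !(mulnC M.+1) ![(_ + _ * _)%N]addnC !modnMDl !modn_small.
  have E2 : t.1.2 = t'.1.2.
    by move: E; rewrite E1 => /eqP; rewrite eqn_add2l eqn_mul2l /= => /eqP.
  have E3 : t.1 = t'.1 by rewrite [LHS]surjective_pairing E1 E2 -surjective_pairing.
  rewrite -(nth_index t rt) -(nth_index t rt'); congr nth.
  apply/eqP; rewrite -(nth_uniq t.1 _ _ ur) ?size_map ?index_mem //.
  by rewrite !(nth_map t) ?index_mem // !nth_index // E3.
apply: (poly_sparse_eq0 (map_uniq ur) ie); apply: poly_nat_roots => n.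
rewrite horner_sum; set u : C := n.+2%:R.
have gt1 m : u ^+ m.+1 != 1.
  by rewrite /u -natrX -[1]/(1%:R) eqr_nat -(exp1n m.+1) eqn_exp2r.
have un0 : u != 0 by rewrite pnatr_eq0.
pose v := u ^+ M.+1.
have [hs c12 c23] := heron_param u v.
have := zf _ _ _ _ hs; rewrite /f c12 c23 (homogenize_sum _ _ _ _ leM) => /eqP.
(* Either a cleared denominator vanishes, which is excluded since [u] is an integer at least [2], or
   the sum itself does. *)
rewrite mulf_eq0 => /orP[|/eqP].
  have a1 : u ^+ 2 - 1 != 0 by rewrite subr_eq0.
  have a2 : v ^+ 2 - 1 != 0 by rewrite subr_eq0 /v -exprM mulnC gt1.
  have a3 : u ^+ 2 * v ^+ 2 - 1 != 0 by rewrite subr_eq0 /v -exprM -exprD gt1.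
  by rewrite mulf_eq0 !expf_eq0 !mulf_eq0 (negPf a1) (negPf a2) (negPf a3) !expf_eq0
    (negPf un0) !pnatr_eq0 !andbF.
move=> r0'; rewrite -[RHS]r0'; apply: eq_bigr => t _.
by rewrite hornerZ hornerXn /v -!exprM -mulrA -exprD /e; congr (_ * _ ^+ _); lia.
Qed.

(** On the surface the numerators for [s0] and [- s0] multiply to [(2 x1 x2) ^+ 2], so neither is
    zero. *)
Let u0_neq0 : u0 != 0.
Proof.
rewrite mulf_neq0 ?invr_eq0 //; apply/eqP => c0.
have : (2%:R * x1 * x2) ^+ 2 = cos_num x1 x2 x3 s0 * cos_num x1 x2 x3 (- s0).
  have -> : cos_num x1 x2 x3 s0 * cos_num x1 x2 x3 (- s0) =
     (x1 ^+ 2 + x2 ^+ 2 - x3 ^+ 2) ^+ 2 - s0 ^+ 2 by rewrite /cos_num; ring.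
  by rewrite s0E /heron; ring.
by rewrite c0 mul0r => /eqP; rewrite expf_eq0 (negPf x12_neq0) andbF.
Qed.

Let v0_neq0 : v0 != 0.
Proof.
rewrite mulf_neq0 ?invr_eq0 //; apply/eqP => c0.
have : (2%:R * x2 * x3) ^+ 2 = cos_num x2 x3 x1 s0 * cos_num x2 x3 x1 (- s0).
  have -> : cos_num x2 x3 x1 s0 * cos_num x2 x3 x1 (- s0) =
     (x2 ^+ 2 + x3 ^+ 2 - x1 ^+ 2) ^+ 2 - s0 ^+ 2 by rewrite /cos_num; ring.
  by rewrite s0E /heron; ring.
by rewrite c0 mul0r => /eqP; rewrite expf_eq0 (negPf x23_neq0) andbF.
Qed.

(** Multiplying by the [N]-th powers of [u0 ^+ 2] and [v0 ^+ 2] makes every exponent natural. *)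
Lemma int_terms_eq0 (r : seq (int * int * int)) : uniq [seq t.1 | t <- r] ->
  \sum_(t <- r) t.2%:~R * (u0 ^+ 2) ^ t.1.1 * (v0 ^+ 2) ^ t.1.2 = 0 ->
  {in r, forall t, t.2 = 0}.
Proof.
move=> ur r0.
pose N := (\max_(t <- r) maxn `|t.1.1| `|t.1.2|)%N.
pose h (m : int) := absz (m + N%:Z).
have leN : {in r, forall t, (h t.1.1)%:Z = t.1.1 + N%:Z /\ (h t.1.2)%:Z = t.1.2 + N%:Z}.
  move=> t rt; have : (maxn `|t.1.1| `|t.1.2| <= N)%N.
    exact: (@leq_bigmax_seq _ r xpredT (fun t => maxn `|t.1.1| `|t.1.2|) t rt).
  by rewrite geq_max => /andP[/absz_shift -> /absz_shift ->].
pose r' := [seq (h t.1.1, h t.1.2, t.2) | t <- r].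
have H : {in r', forall t, t.2 = 0}.
  apply: nat_terms_eq0.
    rewrite -map_comp (eq_map (g := (fun p => (h p.1, h p.2)) \o fst)) // map_comp.
    rewrite map_inj_in_uniq // => _ _ /mapP[t rt ->] /mapP[t' rt' ->] /= [E1 E2].
    have [a1 a2] := leN _ rt; have [b1 b2] := leN _ rt'.
    rewrite [LHS]surjective_pairing [RHS]surjective_pairing; congr pair; apply: (addIr N%:Z).
      by rewrite -a1 -b1 E1.
    by rewrite -a2 -b2 E2.
  rewrite big_map /=.
  transitivity ((u0 ^+ 2) ^+ N * (v0 ^+ 2) ^+ N *
     \sum_(t <- r) t.2%:~R * (u0 ^+ 2) ^ t.1.1 * (v0 ^+ 2) ^ t.1.2); last by rewrite r0 mulr0.
  rewrite mulr_sumr; apply: eq_big_seq => t /leN [E1 E2].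
  have hX (x : C) (m : int) : x != 0 -> (h m)%:Z = m + N%:Z -> x ^+ h m = x ^ m * x ^+ N.
    by move=> x0 Em; rewrite [LHS]exprnP Em expfzDr.
  rewrite !hX ?expf_neq0 //; move: (_ ^ t.1.1) (_ ^ t.1.2) => X Y; ring.
by move=> t rt; apply: (H (h t.1.1, h t.1.2, t.2)); apply/mapP; exists t.
Qed.

End AlgIndep.

(** * Affine form of the isometries *)

Lemma conjcD (x y : C) : conjc (x + y) = conjc x + conjc y.
Proof. exact: rmorphD. Qed.

Lemma conjcB (x y : C) : conjc (x - y) = conjc x - conjc y.
Proof. exact: rmorphB. Qed.

Lemma conjcM (x y : C) : conjc (x * y) = conjc x * conjc y.
Proof. exact: rmorphM. Qed.

Lemma conjcV (x : C) : conjc x^-1 = (conjc x)^-1.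
Proof. exact: fmorphV. Qed.

Definition cj (e : bool) (z : C) : C := if e then conjc z else z.

Lemma cj0 e : cj e 0 = 0.
Proof. by case: e => //; exact: conjc0. Qed.

Lemma cj_eq0 e x : (cj e x == 0) = (x == 0).
Proof. by case: e => //; exact: conjc_eq0. Qed.

Lemma cjD e x y : cj e (x + y) = cj e x + cj e y.
Proof. by case: e => //=; rewrite rmorphD. Qed.

Lemma cjM e x y : cj e (x * y) = cj e x * cj e y.
Proof. by case: e => //=; rewrite rmorphM. Qed.

Lemma cjK e x : cj e (cj e x) = x.
Proof. by case: e => //=; rewrite conjcK. Qed.

Lemma cj_addb e e' x : cj (e (+) e') x = cj e' (cj e x).
Proof. by case: e; case: e' => //=; rewrite conjcK. Qed.

(** The flag [e] tells whether [g] reverses the orientation. *)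
Definition affine (g : isom) (e : bool) (u c : C) : Prop :=
  forall x, toC (app g x) = u * cj e (toC x) + c.

Lemma affine_one : affine one false 1 0.
Proof. by move=> x; rewrite mul1r addr0. Qed.

Lemma affine_mul g h e e' u u' c c' : affine g e u c -> affine h e' u' c' ->
  affine (mul g h) (e (+) e') (u' * cj e' u) (u' * cj e' c + c').
Proof.
move=> Hg Hh x; rewrite /= Hh Hg cjD cjM.
by rewrite cj_addb; ring.
Qed.

Lemma affine_inv g e u c : u != 0 -> affine g e u c ->
  affine (inv g) e (cj e u^-1) (cj e (- (u^-1 * c))).
Proof.
move=> u0 Hg x; rewrite -cjM -cjD -mulrBr -[in RHS](app_invK g x) Hg /=.
by rewrite addrK mulKf // cjK.
Qed.

Lemma affine_conj g t e u c v : affine g e u c -> affine t false 1 v ->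
  affine (conj g t) false 1 (u * cj e v).
Proof.
move=> Hg Ht x; rewrite /= Hg Ht /= mul1r cjD mulrDr addrAC -Hg app_invK.
by rewrite mul1r.
Qed.

Lemma affine_translation g v : affine g false 1 v -> is_translation g.
Proof.
case: v => a b H; exists (a, b) => x; apply: toC_inj.
by rewrite H /= mul1r toCD.
Qed.

Lemma translation_affine g : is_translation g -> exists v, affine g false 1 v.
Proof. by move=> [v H]; exists (toC v) => x; rewrite H toCD mul1r. Qed.

Lemma affine_translation_inj g h v : affine g false 1 v -> affine h false 1 v -> g = h.
Proof. by move=> Hg Hh; apply: isom_ext => x; apply: toC_inj; rewrite Hg Hh. Qed.

(** Comparing the two affine forms at [0], [1] and [i] fixes in turn the constant, [u] and [e]. *)
Lemma translation_linear_part g e u c : u != 0 -> affine g e u c -> is_translation g ->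
  e = false /\ u = 1.
Proof.
move=> u0 Hg /translation_affine[v Hv].
have H z : u * cj e z + c = z + v.
  by case: z => a b; have := Hg (a, b); rewrite Hv mul1r.
have c_eq : c = v by have := H 0; rewrite cj0 mulr0 !add0r.
have {}H z : u * cj e z = z by apply: (addIr v); rewrite -{1}c_eq.
case: e {Hg} H => H; last by split=> //; have := H 1; rewrite mulr1.
have := H 1; rewrite /cj conjc1 mulr1 => u1.
have /eqP := H (Complex 0 1); rewrite u1 mul1r eq_complex /= eqxx /= -subr_eq0 -opprD oppr_eq0.
by rewrite -[1 + 1]/(2%:R) pnatr_eq0.
Qed.

Lemma affine_npow g u c n : affine g false u c -> exists c', affine (npow g n) false (u ^+ n) c'.
Proof.
move=> Hg; elim: n => [|n [c' IH]]; first by exists 0; exact: affine_one.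
by have := affine_mul Hg IH; rewrite /= -exprSr => H; eexists; exact: H.
Qed.

Lemma affine_ipow g u c m : u != 0 -> affine g false u c ->
  exists c', affine (ipow g m) false (u ^ m) c'.
Proof.
move=> u0 Hg; case: m => n; first exact: affine_npow Hg.
have [c' H] := affine_npow n.+1 (affine_inv u0 Hg).
by exists c'; rewrite /= NegzE -exprnN -exprVn.
Qed.

Lemma affine_translation_npow g v n : affine g false 1 v -> affine (npow g n) false 1 (n%:R * v).
Proof.
move=> Hg; elim: n => [|n IH]; first by rewrite mul0r; exact: affine_one.
by have := affine_mul Hg IH; rewrite /= !mul1r -natr1 mulrDl mul1r addrC.
Qed.

(** With [d = Q - P], twice the projection of [x - P] on the line is
    [(x - P) + (d / conj d) * conj (x - P)]. *)
Lemma affine_reflection P Q : toC Q - toC P != 0 ->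
  let rho := (toC Q - toC P) / conjc (toC Q - toC P) in
  affine (reflection P Q) true rho (toC P - rho * conjc (toC P)).
Proof.
move=> d0 rho x.
rewrite -[LHS]/(toC (refl_fun P Q x)) -[cj true _]/(conjc _) /refl_fun.
rewrite toCB toCZ toCD toCZ RdivE.
have -> (r r' : Rdefinitions.R) : real_complex _ (r / r') = real_complex _ r / real_complex _ r'.
  by rewrite rmorphM fmorphV.
rewrite !dotE !toCB.
have -> : real_complex _ (IZR 2) = 2%:R :> C by rewrite -(rmorph_nat (real_complex _) 2).
rewrite {}/rho; set d := toC Q - toC P in d0 *.
have db0 : conjc d != 0 by rewrite conjc_eq0.
rewrite (conjcB (toC x)); move: (conjc d) (conjc (toC x)) (conjc (toC P)) db0 => db xb pb db0.
by field; rewrite db0 /= (mulrC db) -mulr2n mulrn_eq0 mulf_eq0 (negPf d0) (negPf db0).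
Qed.

(* The translation vector of [t1 = (r1 r2 r3)^2]; the [y_i] and [b_i] stand for the
   conjugates of the vertices [z_i] and of the constant terms [c_i]. *)
Lemma glide_square_vector (F : fieldType) (z1 z2 z3 y1 y2 y3 : F) :
  let p1 := (z3 - z2) / (y3 - y2) in let p2 := (z1 - z3) / (y1 - y3) in
  let p3 := (z2 - z1) / (y2 - y1) in
  let c1 := z2 - p1 * y2 in let c2 := z3 - p2 * y3 in let c3 := z1 - p3 * y1 in
  let b1 := y2 - p1^-1 * z2 in let b2 := y3 - p2^-1 * z3 in let b3 := y1 - p3^-1 * z1 in
  z3 - z2 != 0 -> z1 - z3 != 0 -> z2 - z1 != 0 ->
  y3 - y2 != 0 -> y1 - y3 != 0 -> y2 - y1 != 0 ->
  p3 * p2^-1 * p1 * (p3^-1 * (p2 * b1 + c2) + b3) + (p3 * (p2^-1 * c1 + b2) + c3) =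
  - ((z1 - z3) * (y2 - y3) - (y1 - y3) * (z2 - z3)) ^+ 2 / ((y2 - y1) * (y3 - y2) * (z1 - z3)).
Proof. by move=> /= *; field; do ?[apply/andP; split]. Qed.

(** For [d] of argument [theta] this is [exp (2 i theta)]; it depends only on the direction of the
    line spanned by [d]. *)
Definition phase (d : C) : C := d / conjc d.

Lemma phase_neq0 d : d != 0 -> phase d != 0.
Proof. by move=> d0; rewrite mulf_neq0 ?invr_eq0 ?conjc_eq0. Qed.

Lemma phase_conj d : conjc (phase d) = (phase d)^-1.
Proof. by rewrite /phase conjcM conjcV conjcK invfM invrK mulrC. Qed.

Lemma phaseB x y : phase (x - y) = phase (y - x).
Proof. by rewrite /phase -(opprB y x) (rmorphN conjc) invrN mulrNN. Qed.

(* The rotation parts of [r2 r3] and [r1 r2], i.e. the rotations by twice the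
   angles at [A1] and [A3]. *)
Definition omega1 (A1 A2 A3 : point) : C :=
  phase (toC A2 - toC A1) / phase (toC A1 - toC A3).
Definition omega3 (A1 A2 A3 : point) : C :=
  phase (toC A1 - toC A3) / phase (toC A3 - toC A2).

Definition multiplicatively_independent (x y : C) : Prop :=
  forall m n : int, x ^ m * y ^ n = 1 -> m = 0 /\ n = 0.

(** * Linear parts and translation vectors in the triangle group *)

Section Triangle.
Variables A1 A2 A3 : point.
Hypothesis nd : nondegenerate A1 A2 A3.
Local Notation z1 := (toC A1).
Local Notation z2 := (toC A2).
Local Notation z3 := (toC A3).
Local Notation rho1 := (phase (z3 - z2)).
Local Notation rho2 := (phase (z1 - z3)).
Local Notation rho3 := (phase (z2 - z1)).
Local Notation G := (triangle_group A1 A2 A3).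
Local Notation t := (t1 A1 A2 A3).
Local Notation s1 := (r1 A1 A2 A3).
Local Notation s2 := (r2 A1 A2 A3).
Local Notation s3 := (r3 A1 A2 A3).
Local Notation w1 := (omega1 A1 A2 A3).
Local Notation w3 := (omega3 A1 A2 A3).

(** A number minus its conjugate: it is purely imaginary and, up to sign, [4 i] times the area. *)
Lemma cross_neq0 : (z1 - z3) * conjc (z2 - z3) - conjc (z1 - z3) * (z2 - z3) != 0.
Proof.
apply/negP; rewrite eq_complex /= => /andP[_ /eqP E]; case: nd; move: E.
case: A1 A2 A3 => [a1 b1] [a2 b2] [a3 b3] /= E.
have two : (2%:R : Rdefinitions.R) != 0 by rewrite pnatr_eq0.
apply: (mulfI two); rewrite mulr0 -[RHS]oppr0 -E !RealsE /=; ring.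
Qed.

Lemma edge1_neq0 : z3 - z2 != 0.
Proof.
apply: contra_neq cross_neq0 => /subr0_eq E.
by rewrite E subrr conjc0 !mulr0 subr0.
Qed.

Lemma edge2_neq0 : z1 - z3 != 0.
Proof.
by apply: contra_neq cross_neq0 => ->; rewrite conjc0 !mul0r subr0.
Qed.

Lemma edge3_neq0 : z2 - z1 != 0.
Proof.
apply: contra_neq cross_neq0 => /subr0_eq ->.
by rewrite mulrC subrr.
Qed.

Let rho1_neq0 : rho1 != 0. Proof. exact: phase_neq0 edge1_neq0. Qed.
Let rho2_neq0 : rho2 != 0. Proof. exact: phase_neq0 edge2_neq0. Qed.
Let rho3_neq0 : rho3 != 0. Proof. exact: phase_neq0 edge3_neq0. Qed.

Let rho1_conj : conjc rho1 = rho1^-1. Proof. exact: phase_conj. Qed.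
Let rho2_conj : conjc rho2 = rho2^-1. Proof. exact: phase_conj. Qed.
Let rho3_conj : conjc rho3 = rho3^-1. Proof. exact: phase_conj. Qed.

Let omega3_neq0 : w3 != 0. Proof. by rewrite mulf_neq0 ?invr_eq0. Qed.
Let omega1_neq0 : w1 != 0. Proof. by rewrite mulf_neq0 ?invr_eq0. Qed.

Let omega3_conj : conjc w3 = w3^-1.
Proof. by rewrite /omega3 (conjcM rho2) conjcV rho1_conj rho2_conj (invfM rho2). Qed.

Let omega1_conj : conjc w1 = w1^-1.
Proof. by rewrite /omega1 (conjcM rho3) conjcV rho2_conj rho3_conj (invfM rho3). Qed.

Let c1 := z2 - rho1 * conjc z2.
Let c2 := z3 - rho2 * conjc z3.
Let c3 := z1 - rho3 * conjc z1.

Let affine_s1 : affine s1 true rho1 c1. Proof. exact: affine_reflection edge1_neq0. Qed.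
Let affine_s2 : affine s2 true rho2 c2. Proof. exact: affine_reflection edge2_neq0. Qed.
Let affine_s3 : affine s3 true rho3 c3. Proof. exact: affine_reflection edge3_neq0. Qed.

Lemma triangle_group_affine g : G g -> exists e u c, u != 0 /\ affine g e u c.
Proof.
elim=> [s [->|[->|->]]||x y _ [e [u [c [u0 H]]]] _ [e' [u' [c' [u0' H']]]]|x _ [e [u [c [u0 H]]]]].
- by exists true, rho1, c1.
- by exists true, rho2, c2.
- by exists true, rho3, c3.
- by exists false, 1, 0; split; [exact: oner_neq0 | exact: affine_one].
- exists (e (+) e'), (u' * cj e' u), (u' * cj e' c + c'); split; last exact: affine_mul.
  by rewrite mulf_neq0 // cj_eq0.
- exists e, (cj e u^-1), (cj e (- (u^-1 * c))); split; last exact: affine_inv.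
  by rewrite cj_eq0 invr_eq0.
Qed.

Local Notation rho := (rho3 * rho2^-1 * rho1).

Let rho_conj : conjc rho = rho^-1.
Proof.
by rewrite (conjcM _ rho1) (conjcM rho3) conjcV rho1_conj rho2_conj rho3_conj
  (invfM (rho3 * _)) (invfM rho3).
Qed.

Let rho_neq0 : rho != 0.
Proof. by do 2!apply: mulf_neq0 => //; rewrite invr_eq0. Qed.

(** The product [r1 r2 r3] is a map [x |-> rho * conj x + c] with [conj rho = rho^-1], so its square
    translates by [v = rho * conj c + c], whence [conj v = rho^-1 * v]. *)
Lemma affine_t1 : exists v, [/\ v != 0, affine t false 1 v & conjc v = rho^-1 * v].
Proof.
have H := affine_mul (affine_mul affine_s1 affine_s2) affine_s3.
have {H} Hw : affine (mul (mul s1 s2) s3) true rho (rho3 * conjc (rho2 * conjc c1 + c2) + c3).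
  by rewrite -rho2_conj -mulrA -{1}(conjcK rho1) -conjcM; exact: H.
set c := rho3 * _ + c3 in Hw.
exists (rho * conjc c + c); split.
(* The closed formula for [v] has the square of the cross term of [cross_neq0] as numerator, up to
   sign. *)
- have := @glide_square_vector C z1 z2 z3 (conjc z1) (conjc z2) (conjc z3).
  cbv zeta; rewrite -!conjcB -!/(phase _) !conjc_eq0.
  move=> /(_ edge1_neq0 edge2_neq0 edge3_neq0 edge1_neq0 edge2_neq0 edge3_neq0).
  have conj_c1 : conjc c1 = conjc z2 - rho1^-1 * z2.
    by rewrite /c1 conjcB (conjcM rho1) conjcK rho1_conj.
  have conj_c2 : conjc c2 = conjc z3 - rho2^-1 * z3.
    by rewrite /c2 conjcB (conjcM rho2) conjcK rho2_conj.
  have conj_c3 : conjc c3 = conjc z1 - rho3^-1 * z1.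
    by rewrite /c3 conjcB (conjcM rho3) conjcK rho3_conj.
  have cE : c = rho3 * (rho2^-1 * c1 + conjc c2) + c3.
    by rewrite /c conjcD (conjcM rho2) conjcK rho2_conj.
  have conj_c : conjc c = rho3^-1 * (rho2 * conjc c1 + c2) + conjc c3.
    by rewrite /c conjcD (conjcM rho3) conjcK rho3_conj.
  rewrite -conj_c1 -conj_c2 -conj_c3 -/c1 -/c2 -/c3 -conj_c -cE => ->.
  rewrite mulf_neq0 ?invr_eq0 // ?oppr_eq0 ?expf_neq0 ?cross_neq0 //.
  rewrite !mulf_eq0 !conjc_eq0 (negPf edge1_neq0) (negPf edge2_neq0).
  by rewrite (negPf edge3_neq0).
- by rewrite -(mulfV rho_neq0) -rho_conj; exact: (affine_mul Hw Hw).
- by clearbody c; rewrite conjcD (conjcM rho) conjcK rho_conj mulrDr mulKf // addrC.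
Qed.

Lemma closure_translation g : normal_closure G t g -> exists v, affine g false 1 v.
Proof.
have [v [_ Hv _]] := affine_t1.
elim=> [_ [h [Gh ->]]||x y _ [u Hu] _ [w Hw]|x _ [u Hu]].
- have [e [u [c [u0 H]]]] := triangle_group_affine Gh.
  by eexists; apply: affine_conj H Hv.
- by exists 0; exact: affine_one.
- by have := affine_mul Hu Hw; rewrite /= mul1r => H; eexists; exact: H.
- by have := affine_inv (oner_neq0 _) Hu; rewrite /= invr1 => H; eexists; exact: H.
Qed.

Lemma closure_triangle_group g : normal_closure G t g -> G g.
Proof.
have Gs1 : G s1 by apply: gen_base; left.
have Gs2 : G s2 by apply: gen_base; right; left.
have Gs3 : G s3 by apply: gen_base; right; right.
have Gt : G t by rewrite /t /t1; do ?apply: gen_mul.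
elim=> [_ [h [Gh ->]]||x y _ Hx _ Hy|x _ Hx].
- by apply: gen_mul => //; apply: gen_mul => //; apply: gen_inv.
- exact: gen_one.
- exact: gen_mul.
- exact: gen_inv.
Qed.

(** Elements of the normal closure are translations, so the linear part is that of the normal
    word. *)
Lemma triangle_group_normal_form g : G g ->
  exists u m n e c, [/\ normal_closure G t u,
    g = mul u (normal_word s1 s2 s3 m n e) &
    affine g e ((if e then rho1 else 1) * cj e (w3 ^ m * w1 ^ n)) c].
Proof.
have K P Q x : app (reflection P Q) (app (reflection P Q) x) = x by exact: refl_fun_invol.
move=> Gg; have [u [m [n [e [Nu E]]]]] := normal_form (K _ _) (K _ _) (K _ _) Gg.
exists u, m, n, e.
have [v Hv] := closure_translation Nu.
have Ha : affine (mul s1 s2) false w3 (rho2 * conjc c1 + c2).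
  by rewrite /omega3 -rho1_conj; exact: (affine_mul affine_s1 affine_s2).
have Hb : affine (mul s2 s3) false w1 (rho3 * conjc c2 + c3).
  by rewrite /omega1 -rho2_conj; exact: (affine_mul affine_s2 affine_s3).
have [ca {}Ha] := affine_ipow m omega3_neq0 Ha.
have [cb {}Hb] := affine_ipow n omega1_neq0 Hb.
have He : exists c, affine (if e then s1 else one) e (if e then rho1 else 1) c.
  by case: (e); [exists c1 | exists 0; exact: affine_one].
have [ce {}He] := He.
have := affine_mul Hv (affine_mul (affine_mul Ha Hb) He).
rewrite /= => H; eexists; split; first exact: Nu.
  exact: E.
rewrite E; move: H; rewrite (mulrC (w1 ^ n)).
have -> : cj e 1 = 1 by rewrite /cj; case: (e); rewrite ?conjc1.
by rewrite mulr1 => H; exact: H.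
Qed.

Lemma translation_subgroup_closure g : multiplicatively_independent w3 w1 ->
  translation_subgroup A1 A2 A3 g <-> normal_closure G t g.
Proof.
move=> indep; split=> [[Gg Tg]|Ng]; last first.
  split; first exact: closure_triangle_group.
  by have [v Hv] := closure_translation Ng; exact: affine_translation Hv.
have [u [m [n [e [c [Nu E Hg]]]]]] := triangle_group_normal_form Gg.
have [|e0 E1] := translation_linear_part _ Hg Tg.
  apply: mulf_neq0; first by case: (e); [exact: rho1_neq0 | exact: oner_neq0].
  by rewrite cj_eq0 mulf_neq0 // expfz_neq0.
move: E1 E; rewrite e0 /= mul1r => /indep[-> ->] ->.
by rewrite (_ : mul u _ = u) //; isom_eq.
Qed.

Lemma conj_class_t1 : exists2 v, v != 0 & forall h, conj_class G t h ->
  exists m n : int, affine h false 1 (w3 ^ m * w1 ^ n * v).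
Proof.
have [v [v0 Hv vc]] := affine_t1; exists v => // _ [g [Gg ->]].
have [u [m [n [e [c [_ _ Hg]]]]]] := triangle_group_normal_form Gg.
have := affine_conj Hg Hv; case: e {Hg} => /= H; last by exists m, n; move: H; rewrite mul1r.
(* Conjugation inverts both rotations; [conj v = rho^-1 * v] with [rho^-1 = rho1^-1 * w1^-1] cancels
   [rho1] and leaves one more factor [w1^-1]. *)
exists (- m), (- n - 1); move: H; congr affine.
have conjcX (x : C) k : conjc (x ^ k) = conjc x ^ k by exact: fmorphXz.
rewrite conjcM !conjcX omega3_conj omega1_conj vc !exprz_inv expfzDr // exprN1.
have -> : rho^-1 = rho1^-1 * w1^-1.
  by rewrite /omega1 (invfM (rho3 / _)) mulrC.
move: (_ ^ (- m)) (_ ^ (- n)) rho1_neq0 omega1_neq0 => X Y.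
by move: (rho1) (w1) => p w p0 w0; field; rewrite p0 w0.
Qed.

End Triangle.

(** * Products of integer powers of translations *)

Lemma int_of_Z_eq0 k : int_of_Z k = 0 -> k = Z0.
Proof. by move=> k0; rewrite -(int_of_ZK k) k0. Qed.

Lemma affine_translation_zpow g v k : affine g false 1 v ->
  affine (zpow g k) false 1 ((int_of_Z k)%:~R * v).
Proof.
move=> Hg; case: k => [|p|p] /=.
- by rewrite mul0r; exact: affine_one.
- exact: affine_translation_npow.
- have Hi := affine_inv (oner_neq0 _) Hg; rewrite /= invr1 mul1r in Hi.
  have := affine_translation_npow (Pos.to_nat p) Hi.
  rewrite NegzE prednK; last by have := Pos2Nat.is_pos p; lia.
  by rewrite mulrN mulrNz mulNr.
Qed.

Lemma IZR_int_of_Z k : IZR k = (int_of_Z k)%:~R.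
Proof.
case: k => [|p|p] //=.
- by rewrite IZRposE INRE -Pos_to_natE.
- rewrite NegzE prednK; last by have := Pos2Nat.is_pos p; lia.
  by rewrite mulrNz -[IZR (Z.neg p)]/(- IZR (Z.pos p))%R IZRposE INRE -Pos_to_natE.
Qed.

Lemma translation_mulC g h : is_translation g -> is_translation h -> mul g h = mul h g.
Proof.
move=> /translation_affine[v Hv] /translation_affine[w Hw].
have H1 := affine_mul Hv Hw; have H2 := affine_mul Hw Hv.
rewrite /= !mul1r in H1 H2; rewrite addrC in H1.
exact: affine_translation_inj H1 H2.
Qed.

(** Each triple in [ts] holds the two exponents of a translation and its multiplicity. The third
    conclusion links triples back to [bs], which the induction needs to keep the exponent pairs
    distinct. *)
Lemma translation_product (B : isom -> Prop) (x y v : C) (bs : list isom) (ks : list Z) :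
  (forall h, B h -> exists m n : int, affine h false 1 (x ^ m * y ^ n * v)) ->
  NoDup bs -> Forall B bs -> length ks = length bs ->
  exists ts : seq (int * int * int),
    [/\ [seq t.2 | t <- ts] = [seq int_of_Z k | k <- ks],
        uniq [seq t.1 | t <- ts],
        {in ts, forall t, exists2 b, In b bs & affine b false 1 (x ^ t.1.1 * y ^ t.1.2 * v)} &
        affine (fold_right mul one (List.map (fun bk => zpow (fst bk) (snd bk)) (combine bs ks)))
          false 1 ((\sum_(t <- ts) t.2%:~R * x ^ t.1.1 * y ^ t.1.2) * v)].
Proof.
move=> HB; elim: bs ks => [|b bs IH] [|k ks] //= ND FB len.
  by exists [::]; split=> //; rewrite big_nil mul0r; exact: affine_one.
have [nb ND'] := (NoDup_cons_iff b bs).1 ND.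
have [Bb FB'] := (Forall_cons_iff B b bs).1 FB.
case: len => len; have [ts [E U I A]] := IH ks ND' FB' len.
have [m [n Hb]] := HB b Bb.
exists ((m, n, int_of_Z k) :: ts); split.
- by rewrite /= E.
(* Equal exponent pairs give equal vectors, hence equal isometries, against [NoDup]. *)
- rewrite /= U andbT; apply/negP => /mapP[t tts mn].
  have [b' b'bs Hb'] := I t tts; case: nb.
  by rewrite (affine_translation_inj Hb (_ : affine b' _ _ _)) //; rewrite -mn in Hb'.
- move=> t; rewrite inE => /orP[/eqP ->|tts]; first by exists b; [left | exact: Hb].
  by have [b' b'bs Hb'] := I t tts; exists b' => //; right.
- have := affine_mul (affine_translation_zpow k Hb) A; rewrite /= !mul1r big_cons /=.
  by congr affine; ring.
Qed.

(** * Angles *)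

Definition expi (x : Rdefinitions.R) : C := Complex (cos x) (sin x).

Arguments expi x%_ring_scope.

Lemma expiD x y : expi (x + y) = expi x * expi y.
Proof.
apply/eqP; rewrite eq_complex /= -RplusE cos_plus sin_plus !RealsE.
by rewrite eqxx [X in _ == X]addrC eqxx.
Qed.

Lemma expi0 : expi 0 = 1.
Proof. by apply/eqP; rewrite eq_complex /= -R0E cos_0 sin_0 !eqxx. Qed.

Lemma expi_neq0 x : expi x != 0.
Proof.
apply/eqP => x0; have := erefl (expi (x - x)); rewrite {1}expiD subrr expi0 x0 mul0r => /eqP.
by rewrite eq_sym oner_eq0.
Qed.

Lemma expiN x : expi (- x) = (expi x)^-1.
Proof.
apply: (mulfI (expi_neq0 x)); rewrite -expiD subrr expi0 mulfV //; exact: expi_neq0.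
Qed.

Lemma expiX x (m : int) : expi x ^ m = expi (m%:~R * x).
Proof.
have H n : expi x ^+ n = expi (n%:R * x).
  elim: n => [|n IH]; first by rewrite mul0r expi0.
  by rewrite exprS IH -expiD -natr1 mulrDl mul1r addrC.
case: m => n; first exact: H.
by rewrite NegzE mulrNz mulNr expiN -H.
Qed.

Lemma expi_double_eq1 x : expi (x + x) = 1 -> exists k : int, x = k%:~R * PI.
Proof.
move=> /eqP; rewrite eq_complex => /andP[/eqP c1 _].
by have [k ->] := cos_double_eq1 _ c1; exists (int_of_Z k); rewrite IZR_int_of_Z.
Qed.

Lemma divc_real (p q r : Rdefinitions.R) :
  Complex p q / real_complex _ r = Complex (p / r) (q / r).
Proof.
rewrite -(fmorphV (real_complex _)); apply/eqP.
by rewrite eq_complex /= !mulr0 subr0 add0r !eqxx.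
Qed.

Lemma toC_orient A B D :
  (toC B - toC A) * conjc (toC D - toC A) = Complex (dot (psub B A) (psub D A)) (orient A B D).
Proof.
case: A B D => [a1 a2] [b1 b2] [d1 d2]; apply/eqP.
by rewrite eq_complex /= /orient /dot /= !RealsE; apply/andP; split; apply/eqP; ring.
Qed.

(** For [w = (B - A) * conj (D - A)], the signed angle has exponential [w / |w|], whose square
    [w / conj w] involves no absolute value. *)
Lemma expi_angle A B D : orient A B D <> IZR 0 ->
  let s := sign_of (orient A B D) in
  expi (s * angle A B D + s * angle A B D) =
  phase (toC B - toC A) / phase (toC D - toC A).
Proof.
move=> o0 s; rewrite /phase; have [r0 [rE [cE sE]]] := cos_sin_angle A B D o0.
have rn0 : real_complex _ (Rmult (dist A B) (dist A D)) != 0.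
  by rewrite eq_complex /= eqxx andbT; apply/eqP => r0'; move: r0; rewrite r0' => /Rlt_irrefl.
set w := (toC B - toC A) * conjc (toC D - toC A).
have wE : expi (s * angle A B D) = w / real_complex _ (Rmult (dist A B) (dist A D)).
  by rewrite /w toC_orient divc_real /expi -RmultE cE sE !RdivE.
have wr : w * conjc w = real_complex _ (Rmult (dist A B) (dist A D)) ^+ 2.
  transitivity (real_complex _ (Rmult (Rmult (dist A B) (dist A D)) (Rmult (dist A B) (dist A D)))).
    rewrite rE /w toC_orient; apply/eqP; rewrite eq_complex /= !RealsE.
    by apply/andP; split; apply/eqP; ring.
  by rewrite expr2 RmultE rmorphM.
rewrite expiD wE; move: rn0 wr; set r := real_complex _ _ => rn0 wr.
have w0 : w != 0.
  by apply: contra_neq rn0 => w0; apply/eqP; rewrite -sqrf_eq0 -wr w0 mul0r.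
have cw0 : conjc w != 0 by rewrite conjc_eq0.
transitivity (w / conjc w).
  have -> : conjc w = r ^+ 2 / w by rewrite -wr mulrC mulKf.
  by field; rewrite w0 rn0.
move: w0 cw0; rewrite /w (conjcM (toC B - _)) conjcK !mulf_eq0 !negb_or.
move=> /andP[a0 b0] /andP[a0' b0'].
move: (toC B - _) (conjc (toC B - _)) (toC D - _) (conjc (toC D - _)) a0 b0 a0' b0'.
by move=> a a' b b' *; field; do ?[apply/andP; split].
Qed.

(** * Independence of the rotations for typical and generic triangles *)

Section Angles.
Variables A1 A2 A3 : point.
Hypothesis nd : nondegenerate A1 A2 A3.

Lemma orient_neq0 : orient A3 A1 A2 <> IZR 0.
Proof.
move=> o0; apply: nd; move: o0; rewrite /orient /psub /=.
rewrite !RealsE => /eqP o0; apply/eqP; rewrite -oppr_eq0 -(eqP o0); apply/eqP; ring.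
Qed.

(** The three vertices share one orientation, hence one sign [s]. The angle sum enters only as a
    nonzero integer multiple of [PI], up to [s]. *)
Lemma typical_independent :
  typical A1 A2 A3 -> multiplicatively_independent (omega3 A1 A2 A3) (omega1 A1 A2 A3).
Proof.
move=> typ m n mn1.
set s := sign_of (orient A3 A1 A2).
have o1 : orient A1 A2 A3 = orient A3 A1 A2 by rewrite [RHS]orient_rot.
have o2 : orient A2 A3 A1 = orient A3 A1 A2 by rewrite [RHS]orient_rot orient_rot.
have H3 := expi_angle orient_neq0.
have H1 := @expi_angle A1 A2 A3; rewrite o1 in H1; have {}H1 := H1 orient_neq0.
have H2 := @expi_angle A2 A3 A1; rewrite o2 in H2; have {}H2 := H2 orient_neq0.
move: H1 H2 H3; rewrite -/s -/(alpha1 A1 A2 A3) -/(alpha2 A1 A2 A3) -/(alpha3 A1 A2 A3).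
rewrite /typical in typ; move: (alpha1 _ _ _) (alpha2 _ _ _) (alpha3 _ _ _) typ => a1 a2 a3 typ.
move=> H1 H2 H3.
have e1 : phase (toC A2 - toC A3) != 0 by rewrite phaseB; exact: phase_neq0 (edge1_neq0 nd).
have e2 : phase (toC A1 - toC A3) != 0 by exact: phase_neq0 (edge2_neq0 nd).
have e3 : phase (toC A2 - toC A1) != 0 by exact: phase_neq0 (edge3_neq0 nd).
have [j jE] : exists j : int, s * (a1 + a2 + a3) = j%:~R * PI.
  apply: expi_double_eq1.
  transitivity (expi (s * a1 + s * a1) * expi (s * a2 + s * a2) * expi (s * a3 + s * a3)).
    by rewrite -!expiD; congr expi; ring.
  rewrite H1 H2 H3 (phaseB (toC A3) (toC A1)) (phaseB (toC A1) (toC A2)) (phaseB (toC A3) (toC A2)).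
  by move: (phase _) (phase _) (phase _) e1 e2 e3 => p q r *; field; do ?[apply/andP; split].
have [k kE] : exists k : int, s * (m%:~R * a3 + n%:~R * a1) = k%:~R * PI.
  apply: expi_double_eq1.
  rewrite -[RHS]mn1 /omega3 /omega1 (phaseB (toC A3) (toC A2)) -H3 (phaseB (toC A1) (toC A3)) -H1.
  by rewrite !expiX -expiD; congr expi; ring.
have ss : s * s = 1 by exact: sign_of_sqr.
(* Taking [j] times the relation [kE] minus [k] times [jE] eliminates [PI]. *)
have rel : (j * n - k)%:~R * a1 + (- k)%:~R * a2 + (j * m - k)%:~R * a3 = 0.
  transitivity (s * s * ((j * n - k)%:~R * a1 + (- k)%:~R * a2 + (j * m - k)%:~R * a3)).
    by rewrite ss mul1r.
  transitivity (s * (j%:~R * (s * (m%:~R * a3 + n%:~R * a1)) - k%:~R * (s * (a1 + a2 + a3)))).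
    ring.
  by rewrite jE kE; ring.
(* Otherwise the angle sum would be zero, itself a rational relation. *)
have j0 : j != 0.
  apply/eqP => j0.
  have : ratr 1 * a1 + ratr 1 * a2 + ratr 1 * a3 = 0.
    by rewrite rmorph1 !mul1r -[LHS]mul1r -ss -mulrA jE j0 mul0r mulr0.
  by move=> /typ[/eqP]; rewrite oner_eq0.
have := typ (j * n - k)%:~R (- k)%:~R (j * m - k)%:~R.
rewrite !ratr_int => /(_ rel)[/eqP x1 /eqP x2 /eqP x3].
move: x2 x1 x3; rewrite !intr_eq0 oppr_eq0 => /eqP ->.
by rewrite !subr0 !mulf_eq0 (negPf j0) /= => /eqP -> /eqP ->.
Qed.

Lemma dist_sqrC P Q : real_complex _ (dist P Q) ^+ 2 = (toC P - toC Q) * conjc (toC P - toC Q).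
Proof.
transitivity (real_complex _ (Rmult (dist P Q) (dist P Q))); first by rewrite expr2 RmultE rmorphM.
rewrite dist_sqr; apply/eqP; rewrite eq_complex /= /dot /= !RealsE.
by apply/andP; split; apply/eqP; ring.
Qed.

(** With [u = a - c] and [v = b - c], the numerator reduces to [(2 k u * conj v) ^+ 2], and the
    quotient to [u * conj v / (v * conj u)]. The factor [k] is the square of the scale. *)
Lemma law_of_cosines_phase (k a b c s : C) : k != 0 -> c - b != 0 -> a - c != 0 ->
  s = (a - c) * conjc (b - c) - conjc (a - c) * (b - c) ->
  (k * ((b - c) * conjc (b - c)) + k * ((c - a) * conjc (c - a))
     - k * ((a - b) * conjc (a - b)) + k * s) ^+ 2
  / (4%:R * (k * ((b - c) * conjc (b - c))) * (k * ((c - a) * conjc (c - a)))) =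
  phase (a - c) / phase (c - b).
Proof.
move=> k0 cb ac ->; rewrite /phase.
have := cb; have := ac; rewrite -(conjc_eq0 (c - b)) -(conjc_eq0 (a - c)) !conjcB.
move: (conjc a) (conjc b) (conjc c) => a' b' c' ac' cb'.
have four : (4%:R : C) != 0 by rewrite pnatr_eq0.
have bc : b - c != 0 by rewrite -opprB oppr_eq0.
have ca : c - a != 0 by rewrite -opprB oppr_eq0.
have bc' : b' - c' != 0 by rewrite -opprB oppr_eq0.
have ca' : c' - a' != 0 by rewrite -opprB oppr_eq0.
field.
by do ?[apply/andP; split].
Qed.

Lemma generic_independent : generic A1 A2 A3 ->
  forall r : seq (int * int * int), uniq [seq t.1 | t <- r] ->
  \sum_(t <- r) t.2%:~R * omega3 A1 A2 A3 ^ t.1.1 * omega1 A1 A2 A3 ^ t.1.2 = 0 ->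
  {in r, forall t, t.2 = 0}.
Proof.
move=> [k [k0 indep]] r ur r0.
have kn0 : k != 0 by apply/eqP => k0'; move: k0; rewrite k0' => /Rlt_irrefl.
set K := real_complex _ k; have Kn0 : K != 0 by rewrite eq_complex /= eqxx andbT.
have [e1 e2 e3] := And3 (edge1_neq0 nd) (edge2_neq0 nd) (edge3_neq0 nd).
have d0 P Q : toC P - toC Q != 0 -> Rmult k (dist P Q) != 0.
  move=> pq; rewrite mulf_neq0 //; apply: contra_neq pq => d0; apply/eqP.
  have := dist_sqrC P Q; rewrite d0 rmorph0 expr0n => /esym/eqP.
  by rewrite mulf_eq0 conjc_eq0 orbb.
have sqE P Q : real_complex _ (Rmult k (dist P Q)) ^+ 2 =
    K ^+ 2 * ((toC P - toC Q) * conjc (toC P - toC Q)).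
  by rewrite RmultE rmorphM exprMn dist_sqrC.
set o := orient A3 A1 A2.
(* As [o] is twice the signed area, [i sg] is [4 i] times the signed area of the triangle scaled by
   [k]. *)
pose sg := k ^+ 2 * (o + o).
have sgE : Complex 0 sg = K ^+ 2 *
    ((toC A1 - toC A3) * conjc (toC A2 - toC A3) - conjc (toC A1 - toC A3) * (toC A2 - toC A3)).
  have -> : conjc (toC A1 - toC A3) * (toC A2 - toC A3) =
      conjc ((toC A1 - toC A3) * conjc (toC A2 - toC A3)) by rewrite conjcM conjcK.
  have -> : K ^+ 2 = real_complex _ (k ^+ 2) by rewrite rmorphXn.
  rewrite toC_orient -/o /sg; apply/eqP; rewrite eq_complex /=.
  by apply/andP; split; apply/eqP; ring.
have sgn0 : sg != 0.
  rewrite mulf_neq0 ?expf_neq0 // -mulr2n mulrn_eq0 /=.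
  by apply/eqP; exact: orient_neq0.
have hE : Complex 0 sg ^+ 2 = heron (real_complex _ (Rmult k (len1 A1 A2 A3)))
    (real_complex _ (Rmult k (len2 A1 A2 A3))) (real_complex _ (Rmult k (len3 A1 A2 A3))).
  have heronE x y z : heron x y z = (x ^+ 2) ^+ 2 + (y ^+ 2) ^+ 2 + (z ^+ 2) ^+ 2
      - 2%:R * (x ^+ 2 * y ^+ 2 + y ^+ 2 * z ^+ 2 + z ^+ 2 * x ^+ 2) by rewrite /heron; ring.
  rewrite heronE !sqE sgE !conjcB.
  by move: (conjc (toC A1)) (conjc (toC A2)) (conjc (toC A3)) => *; ring.
have l1n0 : Rmult k (len1 A1 A2 A3) != 0 by apply: d0; rewrite -opprB oppr_eq0.
have l2n0 : Rmult k (len2 A1 A2 A3) != 0 by apply: d0; rewrite -opprB oppr_eq0.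
have l3n0 : Rmult k (len3 A1 A2 A3) != 0 by apply: d0; rewrite -opprB oppr_eq0.
have := int_terms_eq0 indep l1n0 l2n0 l3n0 sgn0 hE ur.
have divE (x y z s : C) : (cos_num x y z s / (2%:R * x * y)) ^+ 2 =
    (x ^+ 2 + y ^+ 2 - z ^+ 2 + s) ^+ 2 / (4%:R * x ^+ 2 * y ^+ 2).
  by rewrite expr_div_n !exprMn -natrX.
rewrite !divE !sqE sgE.
have rot : (toC A1 - toC A3) * conjc (toC A2 - toC A3) - conjc (toC A1 - toC A3) * (toC A2 - toC A3)
    = (toC A2 - toC A1) * conjc (toC A3 - toC A1) - conjc (toC A2 - toC A1) * (toC A3 - toC A1).
  by rewrite !conjcB; ring.
(* The squared quotients are [omega3] and [omega1], the second after a cyclic shift of the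
   vertices. *)
have w3E := law_of_cosines_phase (expf_neq0 2 Kn0) e1 e2 erefl.
have w1E := law_of_cosines_phase (expf_neq0 2 Kn0) e2 e3 rot.
by rewrite w3E w1E; apply.
Qed.

End Angles.

(** * The translation subgroup as a normal closure, and its freeness *)

Theorem theorem4p1 (A1 A2 A3 : point) :
  nondegenerate A1 A2 A3 ->
  (typical A1 A2 A3 ->
     forall g, translation_subgroup A1 A2 A3 g <->
               normal_closure (triangle_group A1 A2 A3) (t1 A1 A2 A3) g) /\
  (generic A1 A2 A3 ->
     free_abelian_with_basis (translation_subgroup A1 A2 A3)
       (conj_class (triangle_group A1 A2 A3) (t1 A1 A2 A3))).
Proof.
move=> nd; split=> [typ g|gen0].
  exact: translation_subgroup_closure (typical_independent nd typ).
have indep := generic_independent nd gen0.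
have mult : multiplicatively_independent (omega3 A1 A2 A3) (omega1 A1 A2 A3).
  move=> m n mn1; case: (eqVneq (m, n) (0, 0)) => [[-> ->] //|mn0].
  (* A multiplicative relation is a vanishing combination of two distinct monomials with
     coefficients [1] and [-1]. *)
  have := indep [:: (m, n, 1); (0, 0, -1)].
  rewrite /= inE (negPf mn0) !big_cons big_nil /= => /(_ isT).
  rewrite !mul1r mn1 !expr0z !mulr1 mulrN1z addr0 subrr => /(_ erefl (m, n, 1)).
  by rewrite inE eqxx => /(_ isT).
have closure g := translation_subgroup_closure nd g mult.
split; first by move=> g h [_ Tg] [_ Th]; exact: translation_mulC.
split; first by move=> b Bb; apply/closure; exact: gen_base.
split=> [g|bs ks ND FB len prod1]; first exact: closure.
have [v v0 classE] := conj_class_t1 nd.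
have [ts [E U _ A]] := translation_product classE ND FB len.
rewrite prod1 in A.
have s0 : \sum_(t <- ts) t.2%:~R * omega3 A1 A2 A3 ^ t.1.1 * omega1 A1 A2 A3 ^ t.1.2 = 0.
  (* The product is the identity, so evaluating at the origin shows that its translation vector is
     zero. *)
  apply: (mulIf v0); have := esym (A (IZR 0, IZR 0)).
  by rewrite [app _ _]/= [cj _ _]/= mul1r -[RHS]addr0 => /addrI ->; rewrite mul0r.
have z := indep ts U s0.
apply/Forall_forall => k kks; apply: int_of_Z_eq0.
have : int_of_Z k \in [seq int_of_Z k | k <- ks].
  elim: {len prod1 E A} ks kks => //= k' ks IH [->|/IH]; rewrite inE ?eqxx // => ->.
  by rewrite orbT.
by rewrite -E => /mapP[t tts ->]; exact: z.
Qed.
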